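(* Fix $m\in\mathcal M$. Let $I(m)=\{i\in\{1,\dots,d_{\max}\}:A_i(m)=1\}$, with $|I(m)|=d_m$, and let $P_m$ be the permutation matrix that places the coordinates indexed by $I(m)$ before those indexed by its complement $I^c(m)$ while preserving the original order inside each group. Let $T_\phi(\cdot\mid m)$ be a CoSMIC flow (as defined in the context) whose context-to-mask map is the left-aligned one, $C=B\circ P_m\circ A$, and define the left-align-permuted flow $T_\phi^{\triangleleft}:=P_m^{-1}\circ T_\phi\circ P_m$. Define $$\tilde q_\phi^{\triangleleft}(\boldsymbol\theta_m,\mathbf u_{\setminus m}\mid m)=\nu_{d_{\max}}(\mathbf z)\,\big|\det\nabla T_\phi^{\triangleleft}(\mathbf z\mid m)\big|^{-1},\qquad \mathbf z=T_\phi^{\triangleleft,-1}(\boldsymbol\theta_m,\mathbf u_{\setminus m}),$$ where $\boldsymbol\theta_m\in\mathbb R^{d_m}$ collects the output coordinates indexed by $I(m)$ and $\mathbf u_{\setminus m}\in\mathbb R^{d_{\max}-d_m}$ those indexed by $I^c(m)$. Then: (a) there is a probability density $q_\phi(\cdot\mid m)$ on $\mathbb R^{d_m}$ (the flow density of the active block) such that $$\tilde q_\phi^{\triangleleft}(\boldsymbol\theta_m,\mathbf u_{\setminus m}\mid m)=q_\phi(\boldsymbol\theta_m\mid m)\;\nu_{d_{\setminus m}}(\mathbf u_{\setminus m}),\qquad d_{\setminus m}=d_{\max}-d_m;$$ (b) the marginal is consistent: $$\int\tilde q_\phi^{\triangleleft}(\boldsymbol\theta_m,\mathbf u_{\setminus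 m}\mid m)\,d\mathbf u_{\setminus m}=q_\phi(\boldsymbol\theta_m\mid m).$$
   Context: $\mathcal M$ is a finite set of models; model $m$ has parameter dimension $d_m$ and $d_{\max}=\max_m d_m$. $\nu$ is a univariate probability density and $\nu_d=\otimes_d\nu$ its $d$-fold product. Masks: $A_i:\mathcal M\to\{0,1\}$ flags whether coordinate $i\in\{1,\dots,d_{\max}\}$ is active in model $m$, and $A(m)=(A_1(m),\dots,A_{d_{\max}}(m))$. $B_i(b)=(b,\dots,b)\in\{0,1\}^{|\boldsymbol\rho_i|}$ broadcasts a bit to the parameter block of coordinate $i$, and $B$ applies $B_i$ to the $i$-th entry of a bit vector and concatenates. A context-to-mask map $C$ has blocks $C_i(m)\in\{0,1\}^{|\boldsymbol\rho_i|}$; for $C=B\circ P_m\circ A$ the bits are permuted by $P_m$ before broadcasting, so that block $i$ is all ones for $i\le d_m$ and all zeros for $i>d_m$. CoSMIC flow: $\tau_{\boldsymbol\rho}:\mathbb R\to\mathbb R$ is a family of univariate bijections (diffeomorphisms) with a static parameter value $\boldsymbol\rho^{\mathrm{Id}}$ such that $\tau_{\boldsymbol\rho^{\mathrm{Id}}}(z)=z$ for all $z$. A single CoSMIC step maps $\mathbf z=(z^{(1)},\dots,z^{(d_{\max})})$ to the vector with $i$-th coordinate $\tau_{\boldsymbol\rho_i^C}(z^{(i)})$, where $$\boldsymbol\rho_i^C=(\mathbf 1-C_i(m))\,\boldsymbol\rho^{\mathrm{Id}}+C_i(m)\,\boldsymbol\rho_i$$ (componentwise products), and $\boldsymbol\rho_i$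 is the $i$-th output block of an autoregressive network with parameters $\phi$ and context $m$, i.e. $\boldsymbol\rho_i$ is a function of $z^{(1)},\dots,z^{(i-1)}$ and $m$ only. A CoSMIC flow $T_\phi(\cdot\mid m)$ is a composition of finitely many such steps (with the same mask), each of them a diffeomorphism of $\mathbb R^{d_{\max}}$. *)

(* Defs.v *)
From HB Require Import structures.
From mathcomp Require Import all_boot all_order all_algebra all_fingroup.
From mathcomp Require Import all_classical all_reals all_analysis.
Set Implicit Arguments.
Unset Strict Implicit.
Unset Printing Implicit Defensive.
Import Order.TTheory GRing.Theory Num.Theory.
Import numFieldNormedType.Exports.
Local Open Scope classical_set_scope.
Local Open Scope ring_scope.

(* R^n is 'rV[R]_n.  It carries the product sigma-algebra, generated by the   *)
(* coordinate maps, as the library does for n.-tuple.                         *)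
Definition measure_rV_display : measure_display -> measure_display.
Proof. exact. Qed.

Section measurable_rV.
Context {d} {T : measurableType d} (n : nat).

Let coord : 'I_n -> 'rV[T]_n -> T := fun i x => x ord0 i.

Let rV_set0 : g_sigma_preimage coord set0.
Proof. exact: sigma_algebra0. Qed.

Let rV_setC A : g_sigma_preimage coord A -> g_sigma_preimage coord (~` A).
Proof. exact: sigma_algebraC. Qed.

Let rV_bigcup (F : _^nat) : (forall i, g_sigma_preimage coord (F i)) ->
  g_sigma_preimage coord (\bigcup_i (F i)).
Proof. exact: sigma_algebra_bigcup. Qed.

HB.instance Definition _ := @isMeasurable.Build (measure_rV_display d)
  'rV[T]_n (g_sigma_preimage coord) rV_set0 rV_setC rV_bigcup.

Lemma measurable_coord (i : 'I_n) :
  measurable_fun [set: 'rV[T]_n] (fun x => x ord0 i).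
Proof.
move=> _ Y mY; rewrite setTI; apply: sub_sigma_algebra => /=.
rewrite -bigcup_seq/=; exists i => /=; first by rewrite mem_index_enum.
by exists Y => //; rewrite setTI.
Qed.

Lemma measurable_fun_coordP d1 (T1 : measurableType d1) (f : T1 -> 'rV[T]_n) :
  (forall i, measurable_fun [set: T1] (fun x => f x ord0 i)) ->
  measurable_fun [set: T1] f.
Proof.
move=> mf _; suff H : measurable `<=` [set A | measurable (f @^-1` A)].
  by move=> A mA; rewrite setTI; exact: H.
apply: smallest_sub.
  split => //=.
  - by rewrite preimage_set0.
  - by move=> A mA; rewrite setTD preimage_setC; exact: measurableC.
  - by move=> F mF; rewrite preimage_bigcup; exact: bigcup_measurable.
move=> A; rewrite -bigcup_seq/= => -[i _ [B mB <-]].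
by rewrite setTI -comp_preimage -[X in measurable X]setTI; exact: mf.
Qed.

End measurable_rV.

Definition rV_cons (R : realType) n (p : R * 'rV[R]_n) : 'rV[R]_n.+1 :=
  row_mx (p.1%:M : 'rV[R]_1) p.2.

(* The n-fold product of the Lebesgue measure of R. *)
Fixpoint lebesgue_rV (R : realType) (n : nat) : set 'rV[R]_n -> \bar R :=
  if n is n'.+1 then
    pushforward (@lebesgue_measure R \x @lebesgue_rV R n')%E (@rV_cons R n')
  else \d_(0 : 'rV[R]_0).

Section lebesgue_rV_measure.
Local Open Scope ereal_scope.
Variable R : realType.

Let rV_uncons n (x : 'rV[R]_n.+1) : R * 'rV[R]_n :=
  (x ord0 ord0, rsubmx (x : 'rV[R]_(1 + n))).

Let rV_consK n : cancel (@rV_cons R n) (@rV_uncons n).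
Proof.
move=> [a v]; congr pair; last exact: row_mxKr.
rewrite (_ : ord0 = lshift n (ord0 : 'I_1)); last exact/val_inj.
by rewrite [LHS]row_mxEl mxE eqxx mulr1n.
Qed.

Lemma measurable_rV_cons n : measurable_fun setT (@rV_cons R n).
Proof.
apply: measurable_fun_coordP => i.
case: (split_ordP (i : 'I_(1 + n))) => j ->.
- rewrite (_ : (fun _ => _) = fst); first exact: measurable_fst.
  by apply/funext => x; rewrite [LHS]row_mxEl (ord1 j) mxE eqxx mulr1n.
- rewrite (_ : (fun _ => _) = (fun v : 'rV[R]_n => v ord0 j) \o snd).
    exact: (measurableT_comp (measurable_coord j) measurable_snd).
  by apply/funext => x; rewrite [LHS]row_mxEr.
Qed.

Let measurable_rV_uncons n : measurable_fun setT (@rV_uncons n).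
Proof.
apply: measurable_fun_pair; first exact: measurable_coord.
apply: measurable_fun_coordP => i.
under eq_fun do rewrite mxE.
exact: measurable_coord.
Qed.

HB.instance Definition _ n :=
  @isMeasurableFun.Build _ _ _ _ (@rV_cons R n) (@measurable_rV_cons n).

Section step.
Variables (n : nat) (mu : {sigma_finite_measure set 'rV[R]_n -> \bar R}).

Let push := pushforward (@lebesgue_measure R \x mu) (@rV_cons R n).

Let mcons := @measurable_rV_cons n.

Let push0 : push set0 = 0. Proof. exact: measure0. Qed.

Let push_ge0 B : 0 <= push B. Proof. exact: measure_ge0. Qed.

Let push_semi_sigma_additive : semi_sigma_additive push.
Proof. exact: measure_semi_sigma_additive. Qed.

HB.instance Definition _ := isMeasure.Build _ _ _ push
  push0 push_ge0 push_semi_sigma_additive.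

Let push_sigma_finite : sigma_finite setT push.
Proof.
have /sigma_finiteP[F [TF ndF Foo]] := sigma_finiteT (@lebesgue_measure R).
have /sigma_finiteP[G [TG ndG Goo]] := sigma_finiteT mu.
have FK k : @rV_cons R n @^-1` (@rV_uncons n @^-1` (F k `*` G k)) = F k `*` G k.
  by rewrite -comp_preimage; rewrite (_ : _ \o _ = id) ?preimage_id//; exact/funext/rV_consK.
exists (fun k => @rV_uncons n @^-1` (F k `*` G k)) => [|k].
  rewrite -preimage_bigcup (_ : \bigcup_k _ = setT) ?preimage_setT//.
  rewrite -subTset -setXTT TF TG => -[x y] [/= [i _ Fx] [j _ Gy]].
  exists (maxn i j) => //; split => /=.
    by move: x Fx; exact/subsetPset/ndF/leq_maxl.
  by move: y Gy; exact/subsetPset/ndG/leq_maxr.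
have [mF Fk] := Foo k; have [mG Gk] := Goo k; split.
  rewrite -[X in measurable X]setTI; apply: measurable_rV_uncons => //.
  exact: measurableX.
rewrite /push /pushforward FK product_measure1E//.
by rewrite lte_mul_pinfty// ge0_fin_numE.
Qed.

HB.instance Definition _ :=
  Measure_isSigmaFinite.Build _ _ _ push push_sigma_finite.

Lemma lebesgue_rV_step :
  exists nu : {sigma_finite_measure set 'rV[R]_n.+1 -> \bar R},
    push = nu :> (set _ -> _).
Proof. by exists push. Qed.

End step.

Lemma lebesgue_rV_ex n :
  exists mu : {sigma_finite_measure set 'rV[R]_n -> \bar R},
    @lebesgue_rV R n = mu :> (set _ -> _).
Proof.
elim: n => [|n [mu IH]] /=; first by exists (\d_(0%R : 'rV[R]_0)).
by rewrite IH; exact: lebesgue_rV_step.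
Qed.

Variable n : nat.

Let lebesgue_rV0 : @lebesgue_rV R n set0 = 0.
Proof. by have [mu ->] := lebesgue_rV_ex n; rewrite measure0. Qed.

Let lebesgue_rV_ge0 A : 0 <= @lebesgue_rV R n A.
Proof. by have [mu ->] := lebesgue_rV_ex n; rewrite measure_ge0. Qed.

Let lebesgue_rV_semi_sigma_additive : semi_sigma_additive (@lebesgue_rV R n).
Proof.
by have [mu ->] := lebesgue_rV_ex n; exact: measure_semi_sigma_additive.
Qed.

HB.instance Definition _ := isMeasure.Build _ _ _ (@lebesgue_rV R n)
  lebesgue_rV0 lebesgue_rV_ge0 lebesgue_rV_semi_sigma_additive.

Let lebesgue_rV_sigma_finite : sigma_finite setT (@lebesgue_rV R n).
Proof. by have [mu ->] := lebesgue_rV_ex n; exact: sigma_finiteT. Qed.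

HB.instance Definition _ := Measure_isSigmaFinite.Build _ _ _
  (@lebesgue_rV R n) lebesgue_rV_sigma_finite.

End lebesgue_rV_measure.

Definition probability_density d (T : measurableType d) (R : realType)
    (mu : set T -> \bar R) (f : T -> R) :=
  [/\ measurable_fun setT f, forall x, 0 <= f x
    & (\int[mu]_x (f x)%:E = 1)%E].

Definition prod_density (R : realType) (nu : R -> R) n (x : 'rV[R]_n) : R :=
  \prod_(i < n) nu (x ord0 i).

(* C^1 diffeomorphisms.  For the finite-dimensional V at hand, continuity of  *)
(* all directional derivatives is continuity of the differential.             *)
Definition C1 (R : realType) (V W : normedModType R) (f : V -> W) :=
  (forall x, differentiable f x) /\ (forall v, continuous ('D_v f)).

Definition diffeomorphism (R : realType) (V W : normedModType R)
    (f : V -> W) :=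
  exists g : W -> V, [/\ cancel f g, cancel g f, C1 f & C1 g].

(* The library's jacobian acts on row vectors, hence is the transpose of the  *)
(* usual one; pinv setT T is the inverse of a bijective T.                    *)
Definition flow_density (R : realType) (nu : R -> R) n
    (T : 'rV[R]_n -> 'rV[R]_n) (y : 'rV[R]_n) : R :=
  let z := pinv setT T y in
  prod_density nu z * `|\det (jacobian T z)|^-1.

Section left_alignment.
Variable d : nat.

(* enum lists a set of ordinals in increasing order, so the original order is *)
(* kept inside each of the two groups.                                        *)
Definition left_align_seq (I : {set 'I_d}) : seq 'I_d := enum I ++ enum (~: I)%SET.

Lemma perm_left_align_seq I : perm_eq (left_align_seq I) (enum 'I_d).
Proof.
apply: uniq_perm; rewrite ?enum_uniq//.
  rewrite cat_uniq !enum_uniq andbT/=; apply/hasPn => x.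
  by rewrite !mem_enum inE.
by move=> x; rewrite mem_cat !mem_enum inE orbN.
Qed.

Lemma left_align_inj I :
  injective (fun i : 'I_d => nth i (left_align_seq I) i).
Proof.
have eqI := perm_left_align_seq I.
have sz : size (left_align_seq I) = d by rewrite (perm_size eqI) size_enum_ord.
have un : uniq (left_align_seq I) by rewrite (perm_uniq eqI) enum_uniq.
move=> i j; rewrite (set_nth_default i j) ?sz ?ltn_ord// => /eqP.
by rewrite nth_uniq ?sz ?ltn_ord// => /eqP /val_inj.
Qed.

(* The matrix P_m of the left alignment of I is perm_mx (left_align I), and   *)
(* P_m v has i-th coordinate v_(left_align I i).  On row vectors this action  *)
(* is col_perm (left_align I).                                                *)
Definition left_align (I : {set 'I_d}) : 'S_d := perm (@left_align_inj I).

End left_alignment.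

Section cosmic.
Variables (M : finType) (dim : M -> nat).

Definition dmax : nat := \max_(m : M) dim m.

Lemma dim_le_dmax m : (dim m <= dmax)%N.
Proof. exact: leq_bigmax. Qed.

Variable A : 'I_dmax -> M -> bool.

Definition active (m : M) : {set 'I_dmax} := [set i | A i m]%SET.

Definition activity (m : M) : 'rV[bool]_dmax := \row_i A i m.

Variable k : nat.

(* A concatenation of dmax blocks of length k is the matrix with these rows. *)
Definition broadcast (b : 'rV[bool]_dmax) : 'M[bool]_(dmax, k) :=
  \matrix_(i, j) b ord0 i.

Definition left_aligned_mask (m : M) : 'M[bool]_(dmax, k) :=
  broadcast (col_perm (left_align (active m)) (activity m)).

Variable R : realType.

Definition autoregressive (net : M -> 'rV[R]_dmax -> 'M[R]_(dmax, k)) :=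
  forall m (i : 'I_dmax) (z z' : 'rV[R]_dmax),
    (forall j : 'I_dmax, (j < i)%N -> z ord0 j = z' ord0 j) ->
    row i (net m z) = row i (net m z').

Variables (tau : 'rV[R]_k -> R -> R) (rhoId : 'rV[R]_k).
Variable C : M -> 'M[bool]_(dmax, k).

Definition masked_param (c : 'rV[bool]_k) (rho : 'rV[R]_k) : 'rV[R]_k :=
  \row_j ((1 - (c ord0 j)%:R) * rhoId ord0 j + (c ord0 j)%:R * rho ord0 j).

Definition cosmic_step (net : M -> 'rV[R]_dmax -> 'M[R]_(dmax, k)) (m : M)
    (z : 'rV[R]_dmax) : 'rV[R]_dmax :=
  \row_i tau (masked_param (row i (C m)) (row i (net m z))) (z ord0 i).

Definition cosmic_flow L (net : 'I_L -> M -> 'rV[R]_dmax -> 'M[R]_(dmax, k))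
    (m : M) : 'rV[R]_dmax -> 'rV[R]_dmax :=
  \big[(fun f g => f \o g)/id]_(l < L) cosmic_step (net l) m.

Definition left_align_permuted (m : M) (T : 'rV[R]_dmax -> 'rV[R]_dmax) :=
  let s := left_align (active m) in
  fun z => col_perm s^-1%g (T (col_perm s z)).

Definition aligned_vec (m : M) (theta : 'rV[R]_(dim m))
    (u : 'rV[R]_(dmax - dim m)) : 'rV[R]_dmax :=
  castmx (erefl 1%N, subnKC (dim_le_dmax m)) (row_mx theta u).

(* When #|active m| = dim m, this is the vector whose coordinates in active m *)
(* are those of theta, and whose other coordinates are those of u.            *)
Definition split_vec (m : M) (theta : 'rV[R]_(dim m))
    (u : 'rV[R]_(dmax - dim m)) : 'rV[R]_dmax :=
  col_perm (left_align (active m))^-1%g (aligned_vec theta u).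

End cosmic.

(* Main.v *)
Require Import Defs.
From HB Require Import structures.
From mathcomp Require Import all_boot all_order all_algebra all_fingroup.
From mathcomp Require Import all_classical all_reals all_analysis.
From mathcomp Require Import measurable_realfun.
Import Order.TTheory GRing.Theory Num.Theory.
Import numFieldNormedType.Exports.
Local Open Scope classical_set_scope.
Local Open Scope ring_scope.
Set Implicit Arguments.
Unset Strict Implicit.

(* With the left-aligned mask a CoSMIC step acts on the first d_m coordinates *)
(* without looking at the others, and fixes the others.  Hence the aligned    *)
(* flow is S x id with S a composition of triangular diffeomorphisms of       *)
(* R^d_m; its Jacobian determinant is that of S, and conjugating by the       *)
(* permutation changes neither the determinant nor the product density, so    *)
(* the density factors.  That the flow density of S has mass 1 is a change of *)
(* variables, proved for triangular maps by Tonelli and the one-dimensional   *)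
(* case, and stable under composition by the chain rule.                      *)

(** * Continuous functions of row vectors are measurable *)

(** Left alignment turns the mask of [m] into ones on the first [dim m] coordinates and zeros on the
    rest. Masked coordinates receive [rhoId] and stay fixed, while an active coordinate has a
    parameter depending only on earlier, hence active, coordinates. So each step has the form S x id
    ([cosmic_step_acts_on_head]). This form is stable under composition ([acts_on_head_comp]), and
    the density q is the flow density of the resulting S.

    The factorization is then algebra on the inverse flow: [flow_densityE] writes each density
    through its inverse, [det_jacobian_conj_perm] removes the permutations from the determinant,
    [det_jacobian_block] reduces it to that of the inverse of S, and the product density splits over
    the two blocks. The marginal follows because the product density of the tail has mass 1
    ([integral_prod_density]).

    The analytic content is that q has mass 1, which needs a change of variables for S. On the line
    it comes from monotonicity and the fundamental theorem of calculus
    ([ge0_change_of_variables_R]). Tonelli lifts it to triangular maps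
    ([triangular_change_of_variables]), and the chain rule to their compositions
    ([change_of_variables_comp]). *)

Lemma open_measurable_rV (R : realType) n (U : set 'rV[R]_n) :
  open U -> measurable U.
Proof.
move=> oU.
(* Boxes with rational centre and radius are countably many, and each is a finite intersection of
   coordinate preimages. A radius below [e / 2] keeps a box around [x] inside [ball x e]. *)
pose box (p : 'rV[rat]_n * rat) : set 'rV[R]_n :=
  [set x | forall i, `|ratr (p.1 ord0 i) - x ord0 i| < ratr p.2].
have -> : U = \bigcup_(p in [set p | box p `<=` U]) box p.
  apply/seteqP; split=> [x Ux|x [p /= pU]]; last exact: pU.
  have [e e0 eU] : exists2 e : R, 0 < e & ball x e `<=` U.
    have /nbhs_ballP[e e0 eU] : nbhs x U by exact: open_nbhs_nbhs.
    by exists e.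
  have [q] := @rat_in_itvoo R 0 (e / 2) ltac:(by rewrite divr_gt0).
  rewrite in_itv/= => /andP[q0 qe].
  have cP i : {c : rat | ratr c \in `]x ord0 i - ratr q, x ord0 i + ratr q[}.
    by apply: cid; apply: rat_in_itvoo; rewrite ltrD2l gtrN.
  pose c : 'rV[rat]_n := \row_i sval (cP i).
  have cx i : `|ratr (c ord0 i) - x ord0 i| < ratr q.
    by rewrite mxE; have := svalP (cP i); rewrite in_itv/= -ltr_distlC distrC.
  exists (c, q) => //=.
  move=> y /= cy; apply: eU; split=> // i j; rewrite (ord1 i).
  have cyj := cy j.
  suff: `|x ord0 j - y ord0 j| < e by [].
  rewrite (splitr e) (le_lt_trans (ler_distD (ratr (c ord0 j)) _ _))//.
  by apply: ltrD; apply: lt_trans qe => //; rewrite distrC; exact: cx.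
rewrite bigcup_mkcond; apply: countable_bigcupT_measurable => [|p].
  exact: countableP.
case: ifPn => // _.
rewrite (_ : box p = \bigcap_(i in [set: 'I_n])
    ((fun x : 'rV[R]_n => x ord0 i) @^-1`
       [set y | `|ratr (p.1 ord0 i) - y| < ratr p.2])).
  apply: fin_bigcap_measurable => // i _.
  rewrite -[X in measurable X]setTI; apply: measurable_coord => //.
  apply: open_measurable.
  rewrite (_ : [set _ | _] = `](ratr (p.1 ord0 i) - ratr p.2),
                               (ratr (p.1 ord0 i) + ratr p.2)[%classic).
    exact: interval_open.
  by apply/seteqP; split => y /=; rewrite in_itv/= -ltr_distlC.
by apply/seteqP; split => x /= H i //=; exact: H.
Qed.

Lemma continuous_measurable_fun_rV (R : realType) n (f : 'rV[R]_n -> R) :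
  continuous f -> measurable_fun setT f.
Proof.
move=> /continuousP cf; apply: (measurability _ (RGenOpens.measurableE R)).
move=> _ [_ [a [b ->] <-]]; rewrite setTI.
by apply: open_measurable_rV; apply: cf; exact: interval_open.
Qed.

Lemma continuous_measurable_rV (R : realType) n m (f : 'rV[R]_n -> 'rV[R]_m) :
  continuous f -> measurable_fun setT f.
Proof.
move=> cf; apply: measurable_fun_coordP => i.
apply: continuous_measurable_fun_rV => x.
apply: (@continuous_comp _ _ _ f (fun y : 'rV[R]_m => y ord0 i)).
  exact: cf.
exact: coord_continuous.
Qed.

(** * Change of variables on the line *)

Section density_measure.
Local Open Scope ereal_scope.
Context d (T : measurableType d) (R : realType).
Variable mu : {measure set T -> \bar R}.
Variable w : T -> R.
Hypotheses (mw : measurable_fun setT w) (w0 : forall x, (0 <= w x)%R).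

Let mwE : measurable_fun setT (EFin \o w). Proof. exact/measurable_EFinP. Qed.

(* The proofs are arguments so that the measure structure can be inferred.    *)
Definition density_measure
    of measurable_fun setT w & (forall x, (0 <= w x)%R) :=
  fun A : set T => \int[mu]_(x in A) (w x)%:E.

Local Notation dm := (density_measure mw w0).

Let dm0 : dm set0 = 0. Proof. exact: integral_set0. Qed.

Let dm_ge0 A : 0 <= dm A.
Proof. by apply: integral_ge0 => x _; rewrite lee_fin. Qed.

Let dm_sigma_additive : semi_sigma_additive dm.
Proof.
move=> F mF tF mUF; rewrite /density_measure ge0_integral_bigcup//.
- apply: is_cvg_ereal_nneg_natsum_cond => n _ _.
  by apply: integral_ge0 => x _; rewrite lee_fin.
- exact: measurable_funTS.
- by move=> x _; rewrite lee_fin.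
Qed.

HB.instance Definition _ := isMeasure.Build _ _ _ dm
  dm0 dm_ge0 dm_sigma_additive.

Import HBNNSimple.

Let sintegral_density (h : {nnsfun T >-> R}) :
  sintegral dm h = \int[mu]_x ((h x)%:E * (w x)%:E).
Proof.
rewrite sintegralE.
under [RHS]eq_integral.
  move=> x _; rewrite fimfunE -fsumEFin// ge0_mule_fsuml; last first.
    by move=> r; rewrite EFinM nnfun_muleindic_ge0.
  over.
rewrite ge0_integral_fsum//; last 2 first.
- move=> r; apply: emeasurable_funM => //; apply/measurable_EFinP.
  exact: measurable_funM.
- move=> r x _; rewrite mule_ge0 ?lee_fin// -lee_fin EFinM.
  exact: nnfun_muleindic_ge0.
apply: eq_fsbigr => r _.
have [r0|r0] := ltP r 0%R.
  rewrite preimage_nnfun0// measure0 mule0 integral0_eq// => x _.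
  by rewrite indic0 mulr0 mul0e.
under [RHS]eq_integral do rewrite EFinM -muleA.
rewrite ge0_integralZl//; last first.
- by move=> x _; rewrite mule_ge0// lee_fin.
- by apply: emeasurable_funM => //; exact/measurable_EFinP.
congr (_ * _); rewrite /dm/= /density_measure integral_mkcond.
apply: eq_integral => x _; rewrite epatch_indic/= muleC.
by [].
Qed.

(** Simple functions are settled by [sintegral_density]; monotone convergence along simple
    approximations of [f] passes both sides to the limit. *)
Lemma integral_density (f : T -> \bar R) :
  measurable_fun setT f -> (forall x, 0 <= f x) ->
  \int[dm]_x f x = \int[mu]_x (f x * (w x)%:E).
Proof.
move=> mf f0.
pose g := nnsfun_approx measurableT mf.
have mg n : measurable_fun setT (EFin \o g n) by exact/measurable_EFinP.
have gf x : EFin \o g ^~ x @ \oo --> f x by exact: cvg_nnsfun_approx.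
transitivity (limn (fun n => \int[dm]_x (g n x)%:E)).
  rewrite -monotone_convergence//.
  - by apply: eq_integral => x _; apply/esym/cvg_lim => //; exact: gf.
  - by move=> n x _; rewrite lee_fin.
  - by move=> x _ m n mn; rewrite lee_fin; exact/lefP/nd_nnsfun_approx.
transitivity (limn (fun n => \int[mu]_x ((g n x)%:E * (w x)%:E))).
  apply: congr_lim; apply/funext => n.
  by rewrite integralT_nnsfun sintegral_density.
rewrite -monotone_convergence//.
- apply: eq_integral => x _; apply/cvg_lim => //.
  by apply: cvgeZr => //; exact: gf.
- by move=> n; apply: emeasurable_funM; [exact: mg|exact: mwE].
- by move=> n x _; rewrite mule_ge0// lee_fin.
- move=> x _ m n mn; rewrite lee_wpmul2r ?lee_fin//.
  exact/lefP/nd_nnsfun_approx.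
Qed.

End density_measure.

Lemma integral_derive1 (R : realType) (f : R -> R) a b : a <= b ->
  (forall x, derivable f x 1) -> continuous f^`()%classic ->
  (\int[lebesgue_measure]_(x in `[a, b]) (f^`()%classic x)%:E
    = (f b - f a)%:E)%E.
Proof.
move=> + df cdf; rewrite le_eqVlt => /predU1P[->|ab].
  by rewrite set_itv1 integral_set1 subrr.
have cf : continuous f.
  by move=> x; exact/differentiable_continuous/derivable1_diffP.
rewrite (@continuous_FTC2 _ _ f)//.
- exact: continuous_subspaceT.
- split=> //.
  + exact/cvg_at_right_filter/cf.
  + exact/cvg_at_left_filter/cf.
Qed.

Section change_of_variables_R.
Local Open Scope ereal_scope.
Context (R : realType).
Variables h : R -> R.
Hypothesis dh : diffeomorphism h.
Local Notation mu := (@lebesgue_measure R).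

Let ch : continuous h.
Proof.
by case: dh => g [_ _ [dfh _] _] x; exact/differentiable_continuous/dfh.
Qed.

Let derh x : derivable h x 1.
Proof. by case: dh => g [_ _ [dfh _] _]; exact/derivable1_diffP. Qed.

Let cdh : continuous h^`()%classic.
Proof.
case: dh => g [_ _ [_ cf] _].
rewrite (_ : h^`()%classic = (fun x => ('D_(1%R) h x)%R))//.
by apply/funext => x; rewrite derive1E.
Qed.

Let derh_ge0 : {homo h : x y / (x < y)%R} -> forall x, (0 <= h^`()%classic x)%R.
Proof.
move=> inc x; apply: (@incr_derive1_ge0 _ h setT) => //.
- by move=> ? ? _ _; exact: inc.
- by rewrite interiorT.
Qed.

Let derh_le0 : {homo h : x y /~ (x < y)%R} ->
  forall x, (h^`()%classic x <= 0)%R.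
Proof.
move=> dec x; apply: (@decr_derive1_le0 _ h setT) => //.
- by move=> ? ? _ _; exact: dec.
- by rewrite interiorT.
Qed.

(** A continuous injection of the line is strictly monotone, so the preimage is an interval with
    endpoints [g a] and [g b]. The fundamental theorem of calculus applies to [h], or to its
    opposite in the decreasing case. *)
Let integral_preimage a b : (a <= b)%R ->
  \int[mu]_(x in h @^-1` `]a, b]) `|h^`()%classic x|%:E = (b - a)%:E.
Proof.
move=> ab; have [g [hK gK _ _]] := dh.
have mw D : measurable_fun D (fun x => `|h^`()%classic x|%:E).
  apply/measurable_funTS/measurable_EFinP; apply: measurableT_comp => //.
  exact: continuous_measurable_fun.
have [inc|dec] : {homo h : x y / (x < y)%R} \/ {homo h : x y /~ (x < y)%R}.
  have ci : {within [set` `]-oo, +oo[%R], continuous h}.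
    exact: continuous_subspaceT.
  have hI : {in `]-oo, +oo[%R &, injective h}.
    by move=> x y _ _; apply: (can_inj hK).
  have [H|H] := itv_continuous_inj_mono ci hI.
  - by left=> x y; apply: H; rewrite in_itv.
  - by right=> x y; apply: H; rewrite in_itv.
- have mono := leW_mono (le_mono inc).
  have lmono := le_mono inc.
  rewrite (_ : h @^-1` _ = `]g a, g b]%classic); last first.
    apply/seteqP; split=> x /=; rewrite !in_itv/=.
      by rewrite -{1}(gK a) -{1}(gK b) mono lmono.
    by rewrite -[in X in _ -> X](gK a) -[in X in _ -> X](gK b) mono lmono.
  rewrite integral_itv_obnd_cbnd//.
  under eq_integral do rewrite ger0_norm ?derh_ge0//.
  rewrite integral_derive1// ?gK// -lmono !gK//.
- have mono := leW_nmono (le_nmono dec).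
  have lmono := le_nmono dec.
  rewrite (_ : h @^-1` _ = `[g b, g a[%classic); last first.
    apply/seteqP; split=> x /=; rewrite !in_itv/= andbC.
      by rewrite -{1}(gK a) -{1}(gK b) mono lmono.
    by rewrite -[in X in _ -> X](gK a) -[in X in _ -> X](gK b) mono lmono.
  rewrite integral_itv_bndo_bndc//.
  have hN x : (\- h)%R^`()%classic x = (- (h^`()%classic x))%R.
    by rewrite derive1N.
  under eq_integral do rewrite ler0_norm ?derh_le0// -hN.
  rewrite integral_derive1//.
  + by rewrite /= !gK opprK addrC.
  + by rewrite -lmono !gK.
  + by move=> x; apply: derivableN.
  + rewrite (_ : (\- h)%R^`()%classic = (fun x => (- (h^`()%classic x))%R)).
      by move=> x; apply: continuousN; exact: cdh.
    by apply/funext => x; exact: hN.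
Qed.

(** The measure of density |h'| pushed forward by [h] agrees with Lebesgue measure on half-open
    intervals, by [integral_preimage], and so everywhere by uniqueness of Lebesgue measure. *)
Lemma ge0_change_of_variables_R (g : R -> \bar R) :
  measurable_fun setT g -> (forall x, 0 <= g x) ->
  \int[mu]_x (g (h x) * `|h^`()%classic x|%:E) = \int[mu]_x g x.
Proof.
move=> mg g0.
have mh : measurable_fun setT h by exact: continuous_measurable_fun.
have mw : measurable_fun setT (fun x => `|h^`()%classic x|%R).
  apply: measurableT_comp => //.
  exact: continuous_measurable_fun.
have w0 x : (0 <= `|h^`()%classic x|)%R by [].
pose m : {measure set (measurableTypeR R) -> \bar R} :=
  density_measure mu mw w0.
have mgh : measurable_fun setT (g \o h) by exact: measurableT_comp.
rewrite -(integral_density mu mw w0 mgh)//; last by move=> x; exact: g0.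
pose hR : measurableTypeR R -> measurableTypeR R := h.
have mhR : measurable_fun setT hR by [].
pose pm : {measure set (measurableTypeR R) -> \bar R} :=
  measure_function_pushforward__canonical__measure_function_Measure m mhR.
transitivity (\int[pm]_x g x); first by rewrite ge0_integral_pushforward.
apply: (eq_measure_integral mu (m1 := pm)) => A mA _.
apply/esym/lebesgue_measure_unique => // _ [[a b] _ <-].
have [ab|/ltW ba] := leP a b; last first.
  by rewrite /= set_itv_ge ?measure0//= bnd_simp -leNgt.
transitivity ((b - a)%:E : \bar R); last exact/esym/integral_preimage.
rewrite /= lebesgue_measure_itv/= lte_fin -EFinB; case: ltP => // ba.
by rewrite (@le_anti _ _ a b) ?ab// subrr.
Qed.

End change_of_variables_R.

(** * Tonelli and triangular maps *)

Section rV_cons.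
Context (R : realType) (n : nat).
Implicit Types (x : R) (y : 'rV[R]_n).

Lemma rV_cons0 x y : rV_cons (x, y) ord0 ord0 = x.
Proof.
rewrite (_ : ord0 = lshift n (ord0 : 'I_1)); last exact/val_inj.
by rewrite [LHS]row_mxEl mxE eqxx mulr1n.
Qed.

Lemma rV_cons_lift x y (i : 'I_n) :
  rV_cons (x, y) ord0 (lift ord0 i) = y ord0 i.
Proof.
rewrite (_ : lift ord0 i = rshift 1 i); last exact/val_inj.
by rewrite [LHS]row_mxEr.
Qed.

Lemma measurable_rV_cons1 x : measurable_fun setT (fun y => rV_cons (x, y)).
Proof.
apply: measurable_fun_coordP => i; case: (unliftP ord0 i) => [j|] ->.
  by under eq_fun do rewrite rV_cons_lift; exact: measurable_coord.
by under eq_fun do rewrite rV_cons0; exact: measurable_cst.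
Qed.

End rV_cons.

Section tonelli_rV.
Local Open Scope ereal_scope.
Context (R : realType) (n : nat) (f : 'rV[R]_n.+1 -> \bar R).
Hypotheses (mf : measurable_fun setT f) (f0 : forall x, 0 <= f x).

Let mfc : measurable_fun setT (f \o @rV_cons R n).
Proof. by apply: measurableT_comp => //; exact: measurable_rV_cons. Qed.

Lemma integral_lebesgue_rVS :
  \int[@lebesgue_rV R n.+1]_x f x =
  \int[lebesgue_measure]_x \int[@lebesgue_rV R n]_y f (rV_cons (x, y)).
Proof.
transitivity (\int[lebesgue_measure \x @lebesgue_rV R n]_p f (rV_cons p)).
  rewrite /= ge0_integral_pushforward//.
  exact: measurable_rV_cons.
by rewrite fubini_tonelli1.
Qed.

Lemma measurable_integral_rV_cons :
  measurable_fun setT (fun x => \int[@lebesgue_rV R n]_y f (rV_cons (x, y))).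
Proof.
exact: (@measurable_fun_fubini_tonelli_F _ _ _ _ R (@lebesgue_rV R n) _ mfc
  (fun p => f0 _)).
Qed.

End tonelli_rV.

Lemma integral_prod_density (R : realType) (nu : R -> R) n :
  probability_density lebesgue_measure nu ->
  measurable_fun setT (@prod_density R nu n) /\
  (\int[@lebesgue_rV R n]_x (prod_density nu x)%:E = 1)%E.
Proof.
move=> [mnu nu0 nu1].
have mp k : measurable_fun setT (@prod_density R nu k).
  apply: measurable_prod => i _; apply: measurableT_comp => //.
  exact: measurable_coord.
have p0 k x : 0 <= @prod_density R nu k x by apply: prodr_ge0.
have mpE k : measurable_fun setT (fun x => (@prod_density R nu k x)%:E).
  by apply/measurable_EFinP; exact: mp.
split=> //; elim: n => [|n IH].
  rewrite [LHS]integral_dirac//=; last exact: mpE.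
  by rewrite diracT mul1e /prod_density big_ord0.
rewrite integral_lebesgue_rVS; [|exact: mpE|by move=> x; rewrite lee_fin].
rewrite -nu1; apply: eq_integral => x _.
transitivity (\int[@lebesgue_rV R n]_y ((nu x)%:E * (prod_density nu y)%:E))%E.
  apply: eq_integral => y _; rewrite -EFinM /prod_density big_ord_recl rV_cons0.
  by under eq_bigr do rewrite rV_cons_lift.
rewrite ge0_integralZl//; first by rewrite IH mule1.
- exact: mpE.
- by move=> y _; rewrite lee_fin.
- by rewrite lee_fin.
Qed.

Section triangular.
Local Open Scope ereal_scope.
Context (R : realType).

(* The coordinates are integrated in order: once those before the i-th are    *)
(* fixed, the i-th factor is a change of variables on the line.               *)
Lemma triangular_change_of_variables n (t : 'I_n -> 'rV[R]_n -> R -> R)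
    (g : 'rV[R]_n -> \bar R) :
  (forall (i : 'I_n) (x y : 'rV[R]_n),
    (forall j : 'I_n, (j < i)%N -> x ord0 j = y ord0 j) ->
    t i x = t i y) ->
  (forall i x, diffeomorphism (t i x)) ->
  (forall i, measurable_fun setT (fun x => t i x (x ord0 i))) ->
  (forall i, measurable_fun setT (fun x => (t i x)^`()%classic (x ord0 i))) ->
  measurable_fun setT g -> (forall x, 0 <= g x) ->
  \int[@lebesgue_rV R n]_x (g (\row_i t i x (x ord0 i))%R
     * (\prod_(i < n) `|(t i x)^`()%classic (x ord0 i)|)%:E)
  = \int[@lebesgue_rV R n]_x g x.
Proof.
elim: n t g => [|n IH] t g tri dt mt mdt mg g0.
  apply: eq_integral => x _.
  by rewrite big_ord0 mule1; congr (g _); rewrite [LHS]thinmx0 [RHS]thinmx0.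
pose F (x : 'rV[R]_n.+1) : 'rV[R]_n.+1 := (\row_i t i x (x ord0 i))%R.
have mF : measurable_fun setT F.
  apply: measurable_fun_coordP => i.
  by under eq_fun do rewrite mxE; exact: mt.
(* No coordinate precedes the first, so its map is constant in the vector argument and the point 0
   is arbitrary. *)
pose t0 := t ord0 0%R.
have t0E x : t ord0 x = t0 by exact: tri.
pose t' x (i : 'I_n) y := t (lift ord0 i) (rV_cons (x, y)).
have FE x y : F (rV_cons (x, y)) =
    rV_cons (t0 x, (\row_i t' x i y (y ord0 i))%R).
  apply/rowP => i; rewrite mxE; case: (unliftP ord0 i) => [j|] ->.
    by rewrite !rV_cons_lift mxE.
  by rewrite !rV_cons0 t0E.
have mabs m (f : 'I_m -> 'rV[R]_m -> R) :
    (forall i, measurable_fun setT (f i)) ->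
    measurable_fun setT (fun x => (\prod_(i < m) `|f i x|)%R%:E).
  move=> mf; apply/measurable_EFinP; apply: measurable_prod => i _.
  by apply: measurableT_comp => //; exact: mf.
have mgF x : measurable_fun setT (fun y => g (rV_cons (x, y))).
  by apply: measurableT_comp => //; exact: measurable_rV_cons1.
have mt' x i : measurable_fun setT (fun y => t' x i y (y ord0 i)).
  rewrite (_ : (fun y => _) =
      (fun z => t (lift ord0 i) z (z ord0 (lift ord0 i)))
      \o (fun y => rV_cons (x, y))); last first.
    by apply/funext => y /=; rewrite rV_cons_lift.
  by apply: measurableT_comp; [exact: mt|exact: measurable_rV_cons1].
have mdt' x i :
    measurable_fun setT (fun y => (t' x i y)^`()%classic (y ord0 i)).
  rewrite (_ : (fun y => _) =
      (fun z => (t (lift ord0 i) z)^`()%classic (z ord0 (lift ord0 i)))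
      \o (fun y => rV_cons (x, y))); last first.
    by apply/funext => y /=; rewrite rV_cons_lift.
  by apply: measurableT_comp; [exact: mdt|exact: measurable_rV_cons1].
rewrite !integral_lebesgue_rVS//; last 2 first.
- apply: emeasurable_funM; first exact: measurableT_comp.
  exact: mabs.
- by move=> x; rewrite mule_ge0// lee_fin prodr_ge0.
pose G x := \int[@lebesgue_rV R n]_y g (rV_cons (x, y)).
transitivity (\int[lebesgue_measure]_x (G (t0 x) * `|t0^`()%classic x|%:E)).
  apply: eq_integral => x _; rewrite muleC.
  (* With the first input frozen at [x], the remaining family [t' x] is again triangular; the
     integrand is frozen at the first output [t0 x]. *)
  rewrite /G -(IH (t' x) (fun y => g (rV_cons (t0 x, y))))//; last first.
  - by move=> i y; exact: dt.
  - move=> i y z yz; apply: tri => j; case: (unliftP ord0 j) => [k|] ->.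
      by rewrite /= /bump/= ltnS => ki; rewrite !rV_cons_lift yz.
    by rewrite !rV_cons0.
  rewrite -ge0_integralZl//; last 2 first.
  - apply: emeasurable_funM; last exact: mabs.
    apply: (measurableT_comp (mgF _)); apply: measurable_fun_coordP => i.
    by under eq_fun do rewrite mxE; exact: mt'.
  - by move=> y _; rewrite mule_ge0// lee_fin prodr_ge0.
  apply: eq_integral => y _; rewrite -/(F _) FE big_ord_recl EFinM.
  rewrite t0E rV_cons0 muleCA; congr (_ * (_ * _)).
  by congr EFin; apply: eq_bigr => i _; rewrite rV_cons_lift.
apply: ge0_change_of_variables_R; first exact: dt.
- exact: measurable_integral_rV_cons.
- by move=> x; exact: integral_ge0.
Qed.

End triangular.

(** * Differential calculus and flow densities *)

Section C1.
Context (R : realType).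

Lemma continuous_rV (T : topologicalType) n (f : T -> 'rV[R]_n) :
  (forall i, continuous (fun x => f x ord0 i)) -> continuous f.
Proof.
move=> cf x; apply/cvg_ballP => e e0; near=> y; split=> // i j.
rewrite (ord1 i); move: j; near: y; apply: filter_forall => j.
by have /cvg_ballP := cf j x; apply.
Unshelve. all: by end_near. Qed.

Lemma C1_continuous (V W : normedModType R) (f : V -> W) :
  C1 f -> continuous f.
Proof. by move=> [df _] x; exact/differentiable_continuous/df. Qed.

Lemma continuous_mulmx_rV (T : topologicalType) n m (u : T -> 'rV[R]_n)
    (A : T -> 'M[R]_(n, m)) :
  continuous u -> (forall i j, continuous (fun x => A x i j)) ->
  continuous (fun x => u x *m A x).
Proof.
move=> cu cA; apply: continuous_rV => i x.
under eq_fun do rewrite mxE.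
apply: cvg_big => [|j _]; [exact: add_continuous|]; apply: cvgM; last exact: cA.
by apply: (@continuous_comp _ _ _ u (fun y : 'rV[R]_n => y ord0 j));
  [exact: cu|exact: coord_continuous].
Qed.

Lemma linear_continuous_rV n m (f : {linear 'rV[R]_n -> 'rV[R]_m}) :
  continuous f.
Proof.
rewrite (_ : (f : _ -> _) = fun x => x *m lin1_mx f); last first.
  by apply/funext => x; rewrite mul_rV_lin1.
apply: (@continuous_mulmx_rV _ _ _ id (fun=> lin1_mx f)) => [x|i j].
  exact: cvg_id.
exact: cst_continuous.
Qed.

Lemma C1_linear n m (f : {linear 'rV[R]_n -> 'rV[R]_m}) : C1 f.
Proof.
have df x : differentiable f x.
  exact/linear_differentiable/linear_continuous_rV.
split=> // v; rewrite (_ : 'D_v f = cst (f v)); first exact: cst_continuous.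
apply/funext => x; rewrite deriveE// diff_lin//.
exact: linear_continuous_rV.
Qed.

Lemma jacobian_linear n m (f : {linear 'rV[R]_n -> 'rV[R]_m}) x :
  jacobian f x = lin1_mx f.
Proof. by rewrite /jacobian diff_lin//; exact: linear_continuous_rV. Qed.

Lemma jacobianE n m (f : 'rV[R]_n -> 'rV[R]_m) x i j :
  differentiable f x ->
  jacobian f x i j = ('D_(delta_mx ord0 i) f x) ord0 j.
Proof. by move=> df; rewrite deriveE// mxE. Qed.

(** Vectors are rows, so the factors of the chain rule appear in the order opposite to the usual
    one. *)
Lemma jacobian_comp n m p (f : 'rV[R]_m -> 'rV[R]_p)
    (g : 'rV[R]_n -> 'rV[R]_m) x :
  differentiable g x -> differentiable f (g x) ->
  jacobian (f \o g) x = jacobian g x *m jacobian f (g x).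
Proof.
move=> dg df; apply/row_matrixP => i; rewrite !rowE mulmxA !mul_rV_lin1.
by rewrite diff_comp.
Qed.

Lemma continuous_jacobian n m (f : 'rV[R]_n -> 'rV[R]_m) i j :
  C1 f -> continuous (fun x => jacobian f x i j).
Proof.
move=> [df cf]; under eq_fun do rewrite jacobianE//.
move=> x; apply: (@continuous_comp _ _ _ ('D_(delta_mx ord0 i) f)
  (fun y : 'rV[R]_m => y ord0 j)); first exact: cf.
exact: coord_continuous.
Qed.

Lemma C1_comp n m p (f : 'rV[R]_m -> 'rV[R]_p) (g : 'rV[R]_n -> 'rV[R]_m) :
  C1 f -> C1 g -> C1 (f \o g).
Proof.
move=> Cf Cg; have [[df cf] [dg cg]] := (Cf, Cg).
have dfg x : differentiable (f \o g) x by exact: differentiable_comp.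
split=> // v.
rewrite (_ : 'D_v (f \o g) = fun x => 'D_v g x *m jacobian f (g x)); last first.
  apply/funext => x; rewrite deriveE// diff_comp//= deriveE//.
  by rewrite mul_rV_lin1.
apply: continuous_mulmx_rV => // i j x.
apply: (@continuous_comp _ _ _ g (fun y => jacobian f y i j)).
  exact: C1_continuous.
exact: continuous_jacobian.
Qed.

Lemma diffeomorphism_id n : diffeomorphism (@id 'rV[R]_n).
Proof. by exists id; split=> //; exact: (C1_linear idfun). Qed.

Lemma diffeomorphism_comp n (f g : 'rV[R]_n -> 'rV[R]_n) :
  diffeomorphism f -> diffeomorphism g -> diffeomorphism (f \o g).
Proof.
move=> [f' [fK f'K Cf Cf']] [g' [gK g'K Cg Cg']]; exists (g' \o f').
by split; [exact: can_comp|exact: can_comp|exact: C1_comp|exact: C1_comp].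
Qed.

Lemma diffeomorphism_C1 n (f : 'rV[R]_n -> 'rV[R]_n) : diffeomorphism f -> C1 f.
Proof. by case=> g []. Qed.

Lemma jacobian_id n (x : 'rV[R]_n) : jacobian id x = 1%:M.
Proof.
rewrite (jacobian_linear idfun).
by apply/row_matrixP => i; rewrite !rowE mul_rV_lin1 mulmx1.
Qed.

Lemma det_jacobianK n (f g : 'rV[R]_n -> 'rV[R]_n) x :
  cancel f g -> C1 f -> C1 g ->
  \det (jacobian f x) * \det (jacobian g (f x)) = 1.
Proof.
move=> fK [df _] [dg _]; have := jacobian_comp (df x) (dg (f x)).
rewrite (_ : g \o f = id); last exact/funext.
by rewrite jacobian_id => /(congr1 determinant); rewrite det_mulmx det1.
Qed.

Lemma diffeomorphism_det_neq0 n (f : 'rV[R]_n -> 'rV[R]_n) x :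
  diffeomorphism f -> \det (jacobian f x) != 0.
Proof.
move=> [g [fK _ Cf Cg]].
have unit_factor (a b : R) : a * b = 1 -> a != 0.
  by apply: contra_eqN => /eqP ->; rewrite mul0r eq_sym oner_eq0.
exact: unit_factor (det_jacobianK x fK Cf Cg).
Qed.

Lemma measurable_det_jacobian n (f : 'rV[R]_n -> 'rV[R]_n) :
  C1 f -> measurable_fun setT (fun x => \det (jacobian f x)).
Proof.
move=> Cf; apply: measurable_sum => s.
apply: measurable_funM; first exact: measurable_cst.
apply: measurable_prod => i _.
by apply: continuous_measurable_fun_rV; exact: continuous_jacobian.
Qed.

Lemma pinv_can (T U : pointedType) (f : T -> U) g :
  cancel f g -> cancel g f -> pinv setT f = g.
Proof.
move=> fK gK; apply/funext => y; apply: (can_inj fK); rewrite gK.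
by rewrite pinvK// inE; exists (g y).
Qed.

(** Passing to the inverse map places the determinant at [y] itself and removes both [pinv] and the
    reciprocal; [det_jacobianK] makes the two determinants reciprocal. *)
Lemma flow_densityE (nu : R -> R) n (f g : 'rV[R]_n -> 'rV[R]_n) y :
  cancel f g -> cancel g f -> C1 f -> C1 g ->
  flow_density nu f y = prod_density nu (g y) * `|\det (jacobian g y)|.
Proof.
move=> fK gK Cf Cg.
have normV (a b : R) : a * b = 1 -> `|b|^-1 = `|a|.
  by move=> ab; rewrite -normfV; congr Num.norm; apply: mulr1_eq; rewrite mulrC.
rewrite /flow_density (pinv_can fK gK); congr (_ * _); apply: normV.
exact: det_jacobianK.
Qed.

End C1.

(** * Change of variables in several dimensions *)

Section cov.
Context (R : realType).
Local Open Scope ereal_scope.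

(** Stated as a property of [S], to be proved for triangular maps and propagated through
    compositions, rather than for all diffeomorphisms. *)
Definition change_of_variables n (S : 'rV[R]_n -> 'rV[R]_n) :=
  forall g : 'rV[R]_n -> \bar R,
  measurable_fun setT g -> (forall x, 0 <= g x) ->
  \int[@lebesgue_rV R n]_x (g (S x) * `|\det (jacobian S x)|%:E)
  = \int[@lebesgue_rV R n]_x g x.

Lemma change_of_variables_id n : change_of_variables (@id 'rV[R]_n).
Proof.
move=> g mg g0; apply: eq_integral => x _.
by rewrite jacobian_id det1 normr1 mule1.
Qed.

Lemma change_of_variables_comp n (f g : 'rV[R]_n -> 'rV[R]_n) :
  C1 f -> C1 g -> change_of_variables f -> change_of_variables g ->
  change_of_variables (f \o g).
Proof.
move=> Cf Cg cf cg h mh h0.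
have normM (p : \bar R) (a b : R) :
    p * `|a * b|%:E = p * `|b|%:E * `|a|%:E.
  by rewrite normrM EFinM muleCA muleC.
apply: etrans (cf h mh h0).
apply: etrans (cg (fun y => h (f y) * `|\det (jacobian f y)|%:E) _ _).
- apply: eq_integral => x _ /=.
  rewrite (jacobian_comp (Cg.1 x) (Cf.1 (g x))).
  by rewrite det_mulmx; exact: normM.
- apply: emeasurable_funM.
    apply: measurableT_comp => //; apply: continuous_measurable_rV.
    exact: C1_continuous.
  apply/measurable_EFinP; apply: measurableT_comp => //.
  exact: measurable_det_jacobian.
- by move=> x; rewrite mule_ge0// lee_fin.
Qed.

Lemma change_of_variables_triangular n (t : 'I_n -> 'rV[R]_n -> R -> R)
    (F : 'rV[R]_n -> 'rV[R]_n) :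
  (forall x, F x = (\row_i t i x (x ord0 i))%R) ->
  (forall (i : 'I_n) (x y : 'rV[R]_n),
    (forall j : 'I_n, (j < i)%N -> x ord0 j = y ord0 j) -> t i x = t i y) ->
  (forall i x, diffeomorphism (t i x)) ->
  C1 F -> change_of_variables F.
Proof.
move=> FE tri dt CF g mg g0; have [dF cF] := CF.
have Fi x i : F x ord0 i = t i x (x ord0 i) by rewrite FE mxE.
have J x i j : jacobian F x i j =
    ('D_(delta_mx ord0 i) (fun y => F y ord0 j) x)%R.
  by rewrite jacobianE// derive_mx ?mxE//; exact: diff_derivable.
(* Moving along the i-th axis leaves the earlier coordinates, hence [t i x], unchanged, so the
   difference quotient is that of a univariate map. *)
have Jdiag x i : jacobian F x i i = (t i x)^`()%classic (x ord0 i).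
  rewrite J derive1E /derive.
  rewrite (_ : (fun h => _) = fun h : R => (h^-1 *: ((t i x \o shift (x ord0 i))
     (h *: 1) - t i x (x ord0 i)))%R) //; apply/funext => h /=.
  rewrite (_ : (h *: 1 = h)%R); last exact: mulr1.
  rewrite !Fi (tri i _ x) ?mxE ?eqxx ?mulr1// => j ji.
  by rewrite !mxE eqxx -val_eqE /= (ltn_eqF ji) mulr0 add0r.
(* Row indices are inputs, so the Jacobian is upper triangular; it is transposed because [det_trig]
   expects a lower triangular matrix. *)
have Jtrig x :
    \det (jacobian F x) = (\prod_(i < n) (t i x)^`()%classic (x ord0 i))%R.
  rewrite -det_tr det_trig.
    by apply: eq_bigr => i _; rewrite mxE Jdiag.
  apply/is_trig_mxP => i j ij; rewrite mxE J.
  rewrite /derive (_ : (fun h => _) = cst 0%R).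
    exact: lim_cst.
  apply/funext => h /=.
  rewrite !Fi !mxE eqxx -val_eqE /= (ltn_eqF ij) mulr0 add0r.
  rewrite (tri i _ x) ?subrr ?scaler0// => k ki.
  by rewrite !mxE eqxx -val_eqE /= (ltn_eqF (ltn_trans ki ij)) mulr0 add0r.
(* Nothing is assumed on how [t i x] varies with [x]; measurability comes from [F] being C1, through
   its coordinates and its diagonal derivatives. *)
have mt i : measurable_fun setT (fun x => t i x (x ord0 i)).
  under eq_fun do rewrite -Fi.
  apply: continuous_measurable_fun_rV => x.
  apply: (@continuous_comp _ _ _ F (fun y : 'rV[R]_n => y ord0 i)).
    exact: C1_continuous.
  exact: coord_continuous.
have mdt i : measurable_fun setT (fun x => (t i x)^`()%classic (x ord0 i)).
  under eq_fun do rewrite -Jdiag.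
  by apply: continuous_measurable_fun_rV; exact: continuous_jacobian.
apply: etrans (triangular_change_of_variables tri dt mt mdt mg g0).
apply: eq_integral => x _; rewrite FE; congr (_ * _).
by rewrite Jtrig normr_prod.
Qed.

Lemma flow_density_probability (nu : R -> R) n (S : 'rV[R]_n -> 'rV[R]_n) :
  probability_density lebesgue_measure nu -> diffeomorphism S ->
  change_of_variables S ->
  probability_density (@lebesgue_rV R n) (flow_density nu S).
Proof.
move=> dnu dS cS; have [S' [SK S'K CS CS']] := dS.
have [mp p1] := integral_prod_density n dnu.
have q0 x : (0 <= flow_density nu S x)%R.
  rewrite mulr_ge0 ?invr_ge0// prodr_ge0// => i _.
  by case: dnu => _ + _; exact.
have qE y := flow_densityE nu y SK S'K CS CS'.
have mq : measurable_fun setT (flow_density nu S).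
  rewrite (funext qE).
  apply: measurable_funM; apply: measurableT_comp => //.
    by apply: continuous_measurable_rV; exact: C1_continuous.
  exact: measurable_det_jacobian.
(* Substituting [S x] for the variable, the Jacobian factor cancels the one in the flow density and
   leaves the product density, of mass 1. *)
split=> //; apply: etrans (esym (cS _ _ _)) _.
- exact/measurable_EFinP.
- by move=> x; rewrite lee_fin.
rewrite -p1; apply: eq_integral => x _.
rewrite -EFinM /flow_density (pinv_can SK S'K) SK mulfVK// normr_eq0.
exact: diffeomorphism_det_neq0.
Qed.

End cov.

(** * Flows acting on a leading block *)

Section block.
Context (R : realType).

(** This is [aligned_vec] with a variable [N] in place of [dmax dim], so that destructing [e]
    removes the cast. *)
Definition cast_row_mx n r N (e : (n + r)%N = N) (theta : 'rV[R]_n)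
    (u : 'rV[R]_r) : 'rV[R]_N :=
  castmx (erefl 1%N, e) (row_mx theta u).

Lemma det_jacobian_block n r N (e : (n + r)%N = N) (T : 'rV[R]_N -> 'rV[R]_N)
    (S : 'rV[R]_n -> 'rV[R]_n) theta u :
  (forall theta u, T (cast_row_mx e theta u) = cast_row_mx e (S theta) u) ->
  C1 T -> C1 S ->
  \det (jacobian T (cast_row_mx e theta u)) = \det (jacobian S theta).
Proof.
case: N / e T => T TS [dT _] [dS _]; rewrite /cast_row_mx castmx_id.
have {}TS z : T z = row_mx (S (lsubmx z)) (rsubmx z).
  by have := TS (lsubmx z) (rsubmx z); rewrite /cast_row_mx !castmx_id hsubmxK.
have mulL m (M : 'M[R]_(m, n + r)) : M *m lin1_mx lsubmx = lsubmx M.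
  apply/row_matrixP => i; rewrite row_mul mul_rV_lin1.
  by apply/rowP => j; rewrite !mxE.
have mulR m (M : 'M[R]_(m, n + r)) : M *m lin1_mx rsubmx = rsubmx M.
  apply/row_matrixP => i; rewrite row_mul mul_rV_lin1.
  by apply/rowP => j; rewrite !mxE.
set z := row_mx theta u.
have dl (y : 'rV[R]_(n + r)) : differentiable (lsubmx : _ -> 'rV[R]_n) y.
  by case: (C1_linear (lsubmx : {linear 'rV[R]_(n + r) -> 'rV[R]_n})).
have dr (y : 'rV[R]_(n + r)) : differentiable (rsubmx : _ -> 'rV[R]_r) y.
  by case: (C1_linear (rsubmx : {linear 'rV[R]_(n + r) -> 'rV[R]_r})).
(* The left columns are the Jacobian of [lsubmx \o T], which equals [S \o lsubmx]; the right columns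
   are read off [rsubmx \o T = rsubmx] in the same way. *)
have JL : lsubmx (jacobian T z) = col_mx (jacobian S theta) 0.
  rewrite -mulL -(jacobian_linear lsubmx (T z)) -jacobian_comp//.
  rewrite (_ : lsubmx \o T = S \o lsubmx); last first.
    by apply/funext => y /=; rewrite TS row_mxKl.
  rewrite jacobian_comp// (jacobian_linear lsubmx) row_mxKl.
  rewrite -[lin1_mx _]mul1mx mulL scalar_mx_block block_mxEh row_mxKl.
  by rewrite mul_col_mx mul1mx mul0mx.
have JR : rsubmx (jacobian T z) = col_mx 0 1%:M.
  rewrite -mulR -(jacobian_linear rsubmx (T z)) -jacobian_comp//.
  rewrite (_ : rsubmx \o T = rsubmx); last first.
    by apply/funext => y /=; rewrite TS row_mxKr.
  rewrite (jacobian_linear rsubmx).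
  by rewrite -[lin1_mx _]mul1mx mulR scalar_mx_block block_mxEh row_mxKr.
rewrite -[jacobian T z]hsubmxK JL JR -block_mxEh det_ublock.
by rewrite det1 mulr1.
Qed.

(* Up to the cast along e, T is S x id.                                       *)
Definition acts_on_head n r N (e : (n + r)%N = N) (T : 'rV[R]_N -> 'rV[R]_N) :=
  diffeomorphism T /\ exists S : 'rV[R]_n -> 'rV[R]_n,
    [/\ diffeomorphism S, change_of_variables S
      & forall theta u, T (cast_row_mx e theta u) = cast_row_mx e (S theta) u].

Lemma acts_on_head_id n r N (e : (n + r)%N = N) : acts_on_head e id.
Proof.
split; first exact: diffeomorphism_id.
exists id; split=> //; first exact: diffeomorphism_id.
exact: change_of_variables_id.
Qed.

Lemma acts_on_head_comp n r N (e : (n + r)%N = N) T T' :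
  acts_on_head e T -> acts_on_head e T' -> acts_on_head e (T \o T').
Proof.
move=> [dT [S [dS cS TS]]] [dT' [S' [dS' cS' TS']]].
split; first exact: diffeomorphism_comp.
exists (S \o S'); split; first exact: diffeomorphism_comp.
- by apply: change_of_variables_comp => //; exact: diffeomorphism_C1.
- by move=> theta u; rewrite /= TS' TS.
Qed.

(** The head of the output depends on the head of the input alone, so S is obtained by padding with
    zeros, applying [T] and truncating. The same recipe applied to the inverse of [T] gives the
    inverse of S. *)
Lemma acts_on_head_triangular n r N (e : (n + r)%N = N)
    (t : 'I_N -> 'rV[R]_N -> R -> R) (T : 'rV[R]_N -> 'rV[R]_N) :
  (forall z, T z = \row_i t i z (z ord0 i)) ->
  (forall (i : 'I_N) (x y : 'rV[R]_N),
    (forall j : 'I_N, (j < i)%N -> x ord0 j = y ord0 j) -> t i x = t i y) ->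
  (forall i z, diffeomorphism (t i z)) ->
  (forall (i : 'I_N) z x, (n <= i)%N -> t i z x = x) ->
  diffeomorphism T -> acts_on_head e T.
Proof.
case: N / e t T => t T TE tri dt tid dT; split=> //.
(* Zero padding is written as a matrix product so that it is visibly linear, hence C1. *)
pose S theta := lsubmx (T (theta *m row_mx 1%:M 0)).
pose t' i theta := t (lshift r i) (row_mx theta 0).
have tE i theta u : t (lshift r i) (row_mx theta u) = t' i theta.
  apply: tri => j ji; case: (split_ordP j) => k jk; last first.
    by move: ji; rewrite jk /= ltnNge (leq_trans (ltnW (ltn_ord i)))// leq_addr.
  by rewrite jk !row_mxEl.
have row0 theta : theta *m row_mx 1%:M 0 = row_mx theta (0 : 'rV[R]_r).
  by rewrite mul_mx_row mulmx1 mulmx0.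
have SE theta : S theta = \row_i t' i theta (theta ord0 i).
  by apply/rowP => i; rewrite /S row0 TE [LHS]mxE [LHS]mxE [RHS]mxE row_mxEl tE.
have TS theta u : T (row_mx theta u) = row_mx (S theta) u.
  apply/rowP => i; rewrite TE mxE; case: (split_ordP i) => j ->.
    by rewrite tE !row_mxEl SE mxE.
  by rewrite tid ?leq_addr// !row_mxEr.
have CS (f : 'rV[R]_(n + r) -> 'rV[R]_(n + r)) : C1 f ->
    C1 (fun theta : 'rV[R]_n => lsubmx (f (theta *m row_mx 1%:M 0))).
  move=> Cf; apply: (@C1_comp _ _ _ _ lsubmx (f \o mulmxr (row_mx 1%:M 0))).
    exact: C1_linear.
  by apply: C1_comp => //; exact: C1_linear.
have [T' [TK T'K CT CT']] := dT.
pose S' theta := lsubmx (T' (theta *m row_mx 1%:M 0)).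
exists S; split.
- exists S'; split; [| |exact: CS|exact: CS].
  + by move=> x; rewrite /S' row0 -TS TK row_mxKl.
  (* The tail of [z] need not be known: [T] sends [z] to the padding of [x], and comparing heads
     gives the claim. *)
  + move=> x; rewrite /S' row0; set z := T' _.
    have : T (row_mx (lsubmx z) (rsubmx z)) = row_mx x 0 by rewrite hsubmxK T'K.
    by rewrite TS => /eq_row_mx[].
- apply: (change_of_variables_triangular SE); last exact: CS.
  + move=> i x y xy; apply: tri => j ji; case: (split_ordP j) => k jk.
      by rewrite jk !row_mxEl; apply: xy; move: ji; rewrite jk.
    by rewrite jk !row_mxEr.
  + by move=> i x; exact: dt.
- by move=> theta u; rewrite /cast_row_mx !castmx_id.
Qed.

Lemma prod_density_cast_row_mx (nu : R -> R) n r N (e : (n + r)%N = N) theta u :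
  prod_density nu (cast_row_mx e theta u) =
  prod_density nu theta * prod_density nu u.
Proof.
case: N / e; rewrite /cast_row_mx castmx_id /prod_density big_split_ord/=.
by congr (_ * _); apply: eq_bigr => i _; rewrite ?row_mxEl ?row_mxEr.
Qed.

Lemma prod_density_col_perm (nu : R -> R) n (s : 'S_n) (x : 'rV[R]_n) :
  prod_density nu (col_perm s x) = prod_density nu x.
Proof.
rewrite /prod_density [RHS](reindex_inj (@perm_inj _ s))/=.
by apply: eq_bigr => i _; rewrite mxE.
Qed.

End block.

Lemma det_jacobian_conj_perm (R : realType) n (f : 'rV[R]_n -> 'rV[R]_n)
    (s : 'S_n) x :
  C1 f ->
  \det (jacobian (col_perm s^-1 \o f \o col_perm s) x)
  = \det (jacobian f (col_perm s x)).
Proof.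
move=> [df _].
pose P : {linear 'rV[R]_n -> 'rV[R]_n} := col_perm s.
pose Q : {linear 'rV[R]_n -> 'rV[R]_n} := col_perm s^-1.
have CP : C1 P by exact: C1_linear.
have CQ : C1 Q by exact: C1_linear.
have PK : cancel P Q by move=> z; rewrite /P /Q /= -col_permM mulVg col_perm1.
have detPQ : \det (lin1_mx P) * \det (lin1_mx Q) = 1.
  by rewrite -(det_jacobianK 0 PK CP CQ) !jacobian_linear.
have conj (a b c : R) : a * c = 1 -> a * b * c = b.
  by move=> ac; rewrite mulrAC ac mul1r.
have dfP : differentiable (f \o P) x.
  by apply: differentiable_comp; [exact: CP.1|exact: df].
rewrite [jacobian _ _](jacobian_comp dfP (CQ.1 _)).
rewrite (jacobian_comp (CP.1 x) (df _)).
by rewrite !det_mulmx !jacobian_linear; exact: conj.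
Qed.

(** * Left alignment, CoSMIC steps and the factorization *)

Lemma mem_left_align d (I : {set 'I_d}) i :
  (left_align I i \in I) = (i < #|I|)%N.
Proof.
rewrite permE /left_align_seq nth_cat -cardE; case: ltnP => iI.
  by rewrite -mem_enum mem_nth// -cardE.
apply/negbTE; rewrite -finset.in_setC -mem_enum mem_nth// -cardE.
rewrite [X in (_ < X)%N]cardsCs finset.setCK card_ord.
by rewrite ltn_sub2r// (leq_ltn_trans iI).
Qed.

(** By [mem_left_align], the i-th mask block is all ones exactly when [i < dim m]. The effective
    parameter is thus the network output or [rhoId], both in [Rho], and autoregression makes the
    step triangular. *)
Lemma cosmic_step_acts_on_head (R : realType) (M : finType) (dim : M -> nat)
    (A : 'I_(dmax dim) -> M -> bool) k (Rho : set 'rV[R]_k)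
    (tau : 'rV[R]_k -> R -> R) (rhoId : 'rV[R]_k)
    (net : M -> 'rV[R]_(dmax dim) -> 'M[R]_(dmax dim, k)) (m : M) :
  Rho rhoId -> (forall rho, Rho rho -> diffeomorphism (tau rho)) ->
  (forall z, tau rhoId z = z) -> autoregressive net ->
  (forall z i, Rho (row i (net m z))) -> #|active A m| = dim m ->
  diffeomorphism (cosmic_step tau rhoId (left_aligned_mask A k) net m) ->
  acts_on_head (subnKC (dim_le_dmax dim m))
    (cosmic_step tau rhoId (left_aligned_mask A k) net m).
Proof.
move=> Rho_rhoId tau_diffeo tau_rhoId net_ar net_Rho card_active step_diffeo.
pose rho i z :=
  masked_param rhoId (row i (left_aligned_mask A k m)) (row i (net m z)).
have rhoE i z : rho i z = if (i < dim m)%N then row i (net m z) else rhoId.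
  apply/rowP => j; rewrite mxE.
  have -> : row i (left_aligned_mask A k m) ord0 j = (i < dim m)%N.
    by rewrite !mxE -card_active -mem_left_align inE.
  by case: ifP => _; rewrite ?subrr ?subr0 ?mul0r ?mul1r ?add0r ?addr0.
apply: (@acts_on_head_triangular _ _ _ _ _ (fun i z => tau (rho i z))) => //.
- by move=> i x y xy; rewrite !rhoE (net_ar m i x y xy).
- by move=> i z; apply: tau_diffeo; rewrite rhoE; case: ifP.
- by move=> i z x di; rewrite rhoE ltnNge di tau_rhoId.
Qed.

Theorem proposition2p2 (R : realType) (M : finType) (dim : M -> nat)
    (nu : R -> R) (A : 'I_(dmax dim) -> M -> bool)
    (k : nat) (Rho : set 'rV[R]_k) (tau : 'rV[R]_k -> R -> R)
    (rhoId : 'rV[R]_k) (Phi : Type) (L : nat)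
    (net : 'I_L -> Phi -> M -> 'rV[R]_(dmax dim) -> 'M[R]_(dmax dim, k))
    (phi : Phi) (m : M)
    (nu_density : probability_density lebesgue_measure nu)
    (Rho_rhoId : Rho rhoId)
    (tau_diffeo : forall rho, Rho rho -> diffeomorphism (tau rho))
    (tau_rhoId : forall z, tau rhoId z = z)
    (net_autoregressive : forall l, autoregressive (net l phi))
    (net_Rho : forall l m' z i, Rho (row i (net l phi m' z)))
    (card_active : #|active A m| = dim m)
    (step_diffeo : forall l, diffeomorphism
      (cosmic_step tau rhoId (left_aligned_mask A k) (net l phi) m)) :
  let T := cosmic_flow tau rhoId (left_aligned_mask A k) (net ^~ phi) m in
  let q_tilde (theta : 'rV[R]_(dim m)) (u : 'rV[R]_(dmax dim - dim m)) :=
    flow_density nu (left_align_permuted A m T) (split_vec A theta u) in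
  exists q : 'rV[R]_(dim m) -> R,
    [/\ probability_density (@lebesgue_rV R (dim m)) q,
        (exists2 S : 'rV[R]_(dim m) -> 'rV[R]_(dim m),
          forall theta u, T (aligned_vec theta u) = aligned_vec (S theta) u
          & q = flow_density nu S),
        forall theta u, q_tilde theta u = q theta * prod_density nu u
      & forall theta,
          (\int[@lebesgue_rV R (dmax dim - dim m)]_u (q_tilde theta u)%:E
            = (q theta)%:E)%E].
Proof.
move=> T q_tilde.
pose e := subnKC (dim_le_dmax dim m).
have : acts_on_head e T.
  apply: (big_ind (acts_on_head e)).
  - exact: acts_on_head_id.
  - by move=> f g; exact: acts_on_head_comp.
  - by move=> l _; apply: (@cosmic_step_acts_on_head _ _ _ _ _ Rho) => //.
move=> [[T' [TK T'K CT CT']] [S [dS cS TS]]].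
have [S' [SK S'K CS CS']] := dS.
have T'S theta u : T' (cast_row_mx e theta u) = cast_row_mx e (S' theta) u.
  by rewrite -{1}(S'K theta) -TS TK.
have q_prob := flow_density_probability nu_density dS cS.
pose s := left_align (active A m).
pose P : {linear 'rV[R]_(dmax dim) -> 'rV[R]_(dmax dim)} := col_perm s.
pose Q : {linear 'rV[R]_(dmax dim) -> 'rV[R]_(dmax dim)} := col_perm s^-1.
have PK : cancel P Q.
  by move=> z; rewrite /P /Q /= -col_permM mulVg col_perm1.
have QK : cancel Q P.
  by move=> z; rewrite /P /Q /= -col_permM mulgV col_perm1.
have CP : C1 P by exact: C1_linear.
have CQ : C1 Q by exact: C1_linear.
(* [Tp] is the left-align-permuted flow up to conversion; its inverse is the same conjugate of the
   inverse of [T]. *)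
pose Tp := Q \o T \o P; pose Tp' := Q \o T' \o P.
have TpK : cancel Tp Tp'.
  move=> z; apply: etrans (congr1 (Q \o T') (QK _)) _.
  exact: (etrans (congr1 Q (TK _)) (PK z)).
have Tp'K : cancel Tp' Tp.
  move=> z; apply: etrans (congr1 (Q \o T) (QK _)) _.
  exact: (etrans (congr1 Q (T'K _)) (PK z)).
have CTp : C1 Tp := C1_comp (C1_comp CQ CT) CP.
have CTp' : C1 Tp' := C1_comp (C1_comp CQ CT') CP.
have qE theta u : q_tilde theta u = flow_density nu S theta * prod_density nu u.
  apply: etrans (flow_densityE nu (split_vec A theta u) TpK Tp'K CTp CTp') _.
  rewrite (flow_densityE nu theta SK S'K CS CS').
  have PE : P (split_vec A theta u) = cast_row_mx e theta u by exact: QK.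
  (* The determinant of the inverse flow is now taken at the aligned vector, where the block form
     [T'S] applies. *)
  rewrite [in X in _ * X](det_jacobian_conj_perm s _ CT') -/(P _) PE.
  rewrite (det_jacobian_block _ _ T'S CT' CS').
  have -> : Tp' (split_vec A theta u) = Q (cast_row_mx e (S' theta) u).
    by rewrite -T'S -PE.
  by rewrite prod_density_col_perm prod_density_cast_row_mx mulrAC.
have [mp p1] := integral_prod_density (dmax dim - dim m) nu_density.
have [_ q0 _] := q_prob.
exists (flow_density nu S); split=> //; first by exists S.
move=> theta; under eq_integral do rewrite qE EFinM.
rewrite ge0_integralZl ?lee_fin//.
- by rewrite p1 mule1.
- exact/measurable_EFinP.
- move=> u _; rewrite lee_fin prodr_ge0// => i _.
  by case: nu_density => _ + _; exact.
Qed.
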